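(* Let $F \subset \{1,\dots,n\}$ be a strict subset and let $p \in \{1,\dots,n\}\setminus F$. An operator $T_{(\cdot)}\colon \mathcal{H}^d\to\mathcal{H}^d$ parameterized by $\mathcal{A}_n^F$ is a frugal splitting operator over $\mathcal{A}_n^F$ if and only if it is a generalized primal-dual resolvent with a representation $(p,M,N,U,V)$, where $M\in\mathbb{R}^{n\times n}$, $N\in\mathbb{R}^{n\times d}$, $U\in\mathbb{R}^{d\times d}$, $V\in\mathbb{R}^{d\times n}$, such that (i) $M$ is a $p$-kernel over $\mathcal{A}_n^F$, (ii) $\ker\begin{bmatrix} N & -M\end{bmatrix}\supseteq\ker\begin{bmatrix}U & -V\end{bmatrix}$, (iii) $\operatorname{ran}U\supseteq\operatorname{ran}V$.
   Context: Throughout, $\mathcal{H}$ is a real Hilbert space with $\dim\mathcal{H}\ge 2$, and $n,d\in\mathbb{N}_+=\{1,2,\dots\}$. A set-valued operator $A\colon\mathcal{H}\to2^{\mathcal{H}}$ is called single-valued if $Ax$ is a singleton for every $x\in\mathcal{H}$ (so it has full domain), and is then identified with a map. $J_A=(\mathrm{Id}+A)^{-1}$ is the resolvent, $\operatorname{zer}A=\{x: 0\in Ax\}$, $\operatorname{fix}T=\{z:Tz=z\}$. Operator tuples: for $F\subseteq\{1,\dots,n\}$, $\mathcal{A}_n^F$ is the set of tuples $A=(A_1,\dots,A_n)$ where every $A_i\colon\mathcal{H}\to2^{\mathcal{H}}$ is maximally monotone and $A_i$ is single-valued for all $i\in F$. Parameterized operators: $T_{(\cdot)}\colon X\to Y$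 parameterized by $\mathcal{A}_n^F$ means a map $T_A\colon X\to Y$ for each $A\in\mathcal{A}_n^F$. Matrices as operators: a matrix $B\in\mathbb{R}^{k\times m}$ acts on $z=(z_1,\dots,z_m)\in\mathcal{H}^m$ by $(Bz)_i=\sum_{j=1}^m B_{ij}z_j$, giving $Bz\in\mathcal{H}^k$. Primal-dual operator: for $A\in\mathcal{A}_n^F$ and $p\in\{1,\dots,n\}$, $\Phi_{A,p}=\Delta_{A,p}+\Gamma_p\colon\mathcal{H}^n\to2^{\mathcal{H}^n}$, where $\Delta_{A,p}(y_1,\dots,y_n)=\widehat{A}_1y_1\times\dots\times\widehat{A}_ny_n$ with $\widehat{A}_p=A_p$ and $\widehat{A}_i=A_i^{-1}$ for $i\ne p$, and $\Gamma_p=R_p-R_p^T\in\mathbb{R}^{n\times n}$, where $R_p$ has ones on the $p$th row and zeros elsewhere. Frugal splitting operator: $T_{(\cdot)}\colon\mathcal{H}^d\to\mathcal{H}^d$ parameterized by $\mathcal{A}_n^F$ is a frugal splitting operator over $\mathcal{A}_n^F$ if there exist $d_1,\dots,d_{n+1}\in\mathbb{N}_+$ with $d_1=d_{n+1}=d$ and, for each $i\in\{1,\dots,n\}$, an operator $\tau_{i,(\cdot)}\colon\mathcal{H}^{d_i}\to\mathcal{H}^{d_{i+1}}$ parameterized by $\mathcal{A}_n^F$ such that, for all $A\in\mathcal{A}_n^F$: (1) $\operatorname{fix}T_A\neq\emptyset\iff\operatorname{zer}\sum_{i=1}^nA_i\ne\emptyset$; (2) $T_A=\tau_{n,A}\circ\tau_{n-1,A}\circ\cdots\circ\tau_{1,A}$;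 and moreover for each $i$ there exist $B_i\in\mathbb{R}^{d_{i+1}\times d_i}$, $C_i\in\mathbb{R}^{d_{i+1}\times1}$, $D_i\in\mathbb{R}^{1\times d_i}$, $\gamma_i>0$ (independent of $A$) such that for all $A\in\mathcal{A}_n^F$ and $z_i\in\mathcal{H}^{d_i}$, $\tau_{i,A}z_i=B_iz_i+C_iJ_{\gamma_iA_i}(D_iz_i)$ if $i\notin F$ and $\tau_{i,A}z_i=B_iz_i+C_iA_i(D_iz_i)$ if $i\in F$. Generalized primal-dual resolvent: $T_{(\cdot)}\colon\mathcal{H}^d\to\mathcal{H}^d$ parameterized by $\mathcal{A}_n^F$ is a generalized primal-dual resolvent with representation $(p,M,N,U,V)$, where $p\in\{1,\dots,n\}$, $M\in\mathbb{R}^{n\times n}$, $N\in\mathbb{R}^{n\times d}$, $U\in\mathbb{R}^{d\times d}$, $V\in\mathbb{R}^{d\times n}$, if for all $A\in\mathcal{A}_n^F$ and all $z\in\mathcal{H}^d$, $(M+\Phi_{A,p})^{-1}\circ N$ is single-valued at $z$ and, with $y=(M+\Phi_{A,p})^{-1}Nz\in\mathcal{H}^n$, $T_Az=z-Uz+Vy$. $p$-kernel: $M\in\mathbb{R}^{n\times n}$ is a $p$-kernel over $\mathcal{A}_n^F$ if $p\notin F$, $M+\Gamma_p$ is lower triangular, $M_{i,i}\ge0$ for all $i\in\{1,\dots,n\}$, and $M_{i,i}=0$ if and only if $i\in F$. *)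

(* Defs.v *)
From mathcomp Require Import all_boot all_order all_algebra.
From mathcomp Require Import all_classical all_reals all_analysis.

Set Implicit Arguments.
Unset Strict Implicit.
Unset Printing Implicit Defensive.

Import Order.TTheory GRing.Theory Num.Theory.
Import numFieldNormedType.Exports.
Local Open Scope classical_set_scope.
Local Open Scope ring_scope.

(* A real Hilbert space is a [completeNormedModType R] together with a positive
   definite symmetric bilinear form inducing its norm.  The power H^m is
   ['I_m -> H], with the library's pointwise operations, and indices run from 0
   instead of from 1. *)
Definition induces_norm (R : realType) (H : completeNormedModType R)
    (ip : {dot H for (@idfun R)}) : Prop :=
  forall x : H, `|x| ^+ 2 = ip x x.

Definition dim_ge2 (R : realType) (H : lmodType R) : Prop :=
  exists x y : H, forall a b : R, a *: x + b *: y = 0 -> a = 0 /\ b = 0.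

Section SetValued.
Context {X Y : Type}.
Implicit Types (A : X -> set Y).

Definition op_map (f : X -> Y) : X -> set Y := fun x => [set f x].

Definition op_inv A : Y -> set X := fun y => [set x | A x y].

Definition single_valued A : Prop := forall x, exists u, A x = [set u].

End SetValued.

Definition op_add (X : Type) (Y : zmodType) (A B : X -> set Y) : X -> set Y :=
  fun x => [set u + v | u in A x & v in B x].

Definition op_scale (R : pzRingType) (X : Type) (Y : lmodType R) (a : R)
    (A : X -> set Y) : X -> set Y :=
  fun x => [set a *: u | u in A x].

Definition op_sum (X : Type) (Y : zmodType) (n : nat)
    (A : 'I_n -> X -> set Y) : X -> set Y :=
  fun x => [set \sum_i u i | u in [set u : 'I_n -> Y | forall i, A i x (u i)]].

Definition zer (X : Type) (Y : zmodType) (A : X -> set Y) : set X :=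
  [set x | A x 0].

Definition fix_set (X : Type) (T : X -> X) : set X := [set z | T z = z].

Definition resolvent (X : zmodType) (A : X -> set X) : X -> set X :=
  op_inv (op_add (op_map id) A).

Definition monotone_op (R : realType) (H : completeNormedModType R)
    (ip : {dot H for (@idfun R)}) (A : H -> set H) : Prop :=
  forall x y u v, A x u -> A y v -> 0 <= ip (x - y) (u - v).

Definition maximally_monotone (R : realType) (H : completeNormedModType R)
    (ip : {dot H for (@idfun R)}) (A : H -> set H) : Prop :=
  monotone_op ip A /\
  forall B : H -> set H, monotone_op ip B ->
    (forall x, A x `<=` B x) -> forall x, B x `<=` A x.

Record op_tuple (R : realType) (H : completeNormedModType R)
    (ip : {dot H for (@idfun R)}) (n : nat) (F : {set 'I_n}) := OpTuple {
  op_of :> 'I_n -> H -> set H;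
  op_of_maximal : forall i, maximally_monotone ip (op_of i);
  op_of_single : forall i, i \in F -> single_valued (op_of i) }.

Definition mxop (R : realType) (H : lmodType R) (k m : nat)
    (B : 'M[R]_(k, m)) (z : 'I_m -> H) : 'I_k -> H :=
  fun i => \sum_j B i j *: z j.

Definition ker_mx (R : realType) (H : lmodType R) (k m : nat)
    (B : 'M[R]_(k, m)) : set ('I_m -> H) :=
  [set z | mxop B z = 0].

Definition ran_mx (R : realType) (H : lmodType R) (k m : nat)
    (B : 'M[R]_(k, m)) : set ('I_k -> H) :=
  range (@mxop R H k m B).

Section PrimalDual.
Context {R : realType} {H : completeNormedModType R}.
Context {ip : {dot H for (@idfun R)}} {n : nat} {F : {set 'I_n}}.

Definition Rmat (p : 'I_n) : 'M[R]_n := \matrix_(i, j) (i == p)%:R.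

Definition Gamma (p : 'I_n) : 'M[R]_n := Rmat p - (Rmat p)^T.

Definition hat_op (A : op_tuple ip F) (p i : 'I_n) : H -> set H :=
  if i == p then A i else op_inv (A i).

Definition Delta (A : op_tuple ip F) (p : 'I_n) :
    ('I_n -> H) -> set ('I_n -> H) :=
  fun y => [set v | forall i, hat_op A p i (y i) (v i)].

Definition Phi (A : op_tuple ip F) (p : 'I_n) :
    ('I_n -> H) -> set ('I_n -> H) :=
  op_add (Delta A p) (op_map (mxop (Gamma p))).

End PrimalDual.

Section Splitting.
Context {R : realType} {H : completeNormedModType R}.
Context {ip : {dot H for (@idfun R)}} {n : nat} {F : {set 'I_n}}.

(* The set-valued operator evaluated in the i-th step, at a point of H. *)
Definition step_op (A : op_tuple ip F) (i : 'I_n) (g : R) : H -> set H :=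
  if i \in F then A i else resolvent (op_scale g (A i)).

Definition pow_cast (m k : nat) (e : m = k) (z : 'I_m -> H) : 'I_k -> H :=
  fun i => z (cast_ord (esym e) i).

Fixpoint compose_steps (ds : nat -> nat)
    (tau : forall i, ('I_(ds i) -> H) -> ('I_(ds i.+1) -> H)) (k : nat) :
    ('I_(ds 0) -> H) -> ('I_(ds k) -> H) :=
  if k is k'.+1 then fun z => tau k' (@compose_steps ds tau k' z) else id.

Arguments compose_steps {ds} tau k z.

(* [ds i] is d_{i+1} and [tau i] is tau_{i+1}; only [ds 0 .. ds n] and
   [tau 0 .. tau (n-1)] matter.  The set-valued [step_op A i g] is identified
   with a map through its unique value [w], as every J_{g A_i} and every
   single-valued A_i is singleton-valued. *)
Definition frugal_splitting_operator (d : nat)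
    (T : op_tuple ip F -> ('I_d -> H) -> ('I_d -> H)) : Prop :=
  exists (ds : nat -> nat) (e0 : ds 0%N = d) (en : ds n = d)
    (tau : forall i, op_tuple ip F -> ('I_(ds i) -> H) -> ('I_(ds i.+1) -> H)),
  [/\ forall i, (i <= n)%N -> (0 < ds i)%N,
      forall A, fix_set (T A) !=set0 <-> zer (op_sum A) !=set0,
      forall A z, T A z =
        pow_cast en (compose_steps (tau ^~ A) n (pow_cast (esym e0) z)) &
      forall i : 'I_n,
        exists (B : 'M[R]_(ds i.+1, ds i)) (C : 'M[R]_(ds i.+1, 1))
               (D : 'M[R]_(1, ds i)) (g : R),
        0 < g /\
        forall A (z : 'I_(ds i) -> H), exists w : H,
          step_op A i g (mxop D z ord0) = [set w] /\
          tau i A z = mxop B z + mxop C (fun=> w)].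

Definition generalized_primal_dual_resolvent (d : nat)
    (T : op_tuple ip F -> ('I_d -> H) -> ('I_d -> H))
    (p : 'I_n) (M : 'M[R]_n) (N : 'M[R]_(n, d)) (U : 'M[R]_d)
    (V : 'M[R]_(d, n)) : Prop :=
  forall (A : op_tuple ip F) (z : 'I_d -> H), exists y : 'I_n -> H,
    op_inv (op_add (op_map (mxop M)) (Phi A p)) (mxop N z) = [set y] /\
    T A z = z - mxop U z + mxop V y.

End Splitting.

Definition p_kernel (R : realType) (n : nat) (F : {set 'I_n}) (p : 'I_n)
    (M : 'M[R]_n) : Prop :=
  [/\ p \notin F, is_trig_mx (M + Gamma p),
      forall i, 0 <= M i i & forall i, M i i = 0 <-> i \in F].

(* Main.v *)
Require Import Defs.
From mathcomp Require Import all_boot all_order all_algebra.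
From mathcomp Require Import all_classical all_reals all_analysis.
Set Implicit Arguments.
Unset Strict Implicit.
Unset Printing Implicit Defensive.
Import Order.TTheory GRing.Theory Num.Theory.
Import numFieldNormedType.Exports.
Local Open Scope classical_set_scope.
Local Open Scope ring_scope.

(** Both kinds of operators evaluate each [A i] exactly once, in the order of
    the indices, so the two descriptions are the same triangular system of
    inclusions written in two sets of unknowns.  A step of a frugal operator
    evaluates its argument [q i] to a value [w i]; the primal-dual inclusion has
    the unknown [y i] with [hat_op A p i (y i) (rho q i - delta y i)].  For a
    given argument the two are related by the invertible change of unknown
    [w i = sigma q i + kappa y i], whose coefficients do not depend on [A]
    ([hat_op_step]).

    From steps to resolvent, every intermediate point of the composition is a
    matrix applied to the input plus a matrix applied to [y], the second one
    involving only the entries of [y] computed so far ([traceE]).  Substituting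
    this in the arguments [q i] gives a lower triangular system, and reading off
    its coefficients gives [M], [N], [U] and [V]
    ([frugal_primal_dual_resolvent]).

    From resolvent to steps, the system is solved row by row by a composition
    acting on pairs (input, entries of [y] found so far) in [H^(d + n)]
    ([resolvent_frugal]).  A step must be defined at every point of [H], also
    at those which its argument never reaches.  Minty's theorem would give this;
    here it follows from the resolvent being single-valued for all tuples: put a
    translate of [A i] in row [i], and in the other rows operators which force
    the corresponding entries of [y] to vanish ([step_op_single]).

    The kernel and range conditions encode the equivalence of fixed points and
    zeros.  A fixed point is a [z] with [U z = V y] for the solution [y] of the
    inclusion at [z], and [y p] is a zero of the sum as soon as [N z = M y],
    which the kernel condition gives.  Conversely a zero gives a [y] that solves
    the inclusion with right-hand side [M y]; the range condition gives a [z]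
    with [U z = V y], and then [N z = M y] ([fixed_points_iff_zeros]).
    The conditions are necessary because tuples can be designed around given
    vectors.  With constants and the normal cone of a point, any [y] becomes the
    only possible solution, which gives the range condition
    ([fixed_point_ran]).  With constants and two opposite skew operators, any
    pair with [U z = V y] and [N z <> M y] comes from a fixed point while the
    sum of the operators is a nonzero constant ([fixed_point_ker]).  Nonzero
    skew operators exist because the dimension is at least 2. *)

(** * Maximally monotone operators used as tests *)

Section Monotone.
Context (R : realType) (H : completeNormedModType R).
Context (ip : {dot H for (@idfun R)}).

Lemma ipC (x y : H) : ip x y = ip y x.
Proof. by have := hermC ip x y; rewrite /= expr0 mul1r. Qed.

Lemma ipDl (x y z : H) : ip (x + y) z = ip x z + ip y z.
Proof. exact: linearDl. Qed.

Lemma ipNl (x y : H) : ip (- x) y = - ip x y.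
Proof. exact: linearNl. Qed.

Lemma ipZl (a : R) (x y : H) : ip (a *: x) y = a * ip x y.
Proof. by rewrite linearZl. Qed.

Lemma ip0l (x : H) : ip 0 x = 0.
Proof. exact: linear0l. Qed.

Lemma ipDr (x y z : H) : ip x (y + z) = ip x y + ip x z.
Proof. by rewrite ipC ipDl !(ipC x). Qed.

Lemma ipNr (x y : H) : ip x (- y) = - ip x y.
Proof. by rewrite ipC ipNl ipC. Qed.

Lemma ipZr (a : R) (x y : H) : ip x (a *: y) = a * ip x y.
Proof. by rewrite ipC ipZl ipC. Qed.

Lemma ip_le0 (x : H) : ip x x <= 0 -> x = 0.
Proof.
rewrite leNgt => /negP xx; apply/eqP/negPn/negP => x0; apply: xx.
exact: neq0_dnorm_gt0.
Qed.

(** The normal cone of the set [{a}]. *)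
Definition point_cone (a : H) : H -> set H := fun x _ => x = a.

(** If an extension has a value [v] at [x], monotonicity against the value
    [v + (x - a)] at [a] gives [- |x - a| ^ 2 >= 0]. *)
Lemma point_cone_maximal (a : H) : maximally_monotone ip (point_cone a).
Proof.
split=> [x y u v -> ->|B Bmono sub x v Bxv].
  by rewrite subrr ip0l.
have := Bmono _ _ _ _ Bxv (sub a (v + (x - a)) erefl).
rewrite opprD addNKr ipNr oppr_ge0 => /ip_le0 /eqP.
by rewrite subr_eq0 => /eqP.
Qed.

(** Let an extension have the value [v] at [x], with error [h = v - (c + S x)].
    Monotonicity against the point [x + h] gives [<h, S h> - <h, h> >= 0], whose
    first term vanishes by skewness, so that [h = 0]. *)
Lemma skew_affine_maximal (S : H -> H) (c : H) :
  (forall x y, S (x - y) = S x - S y) -> (forall x, ip x (S x) = 0) ->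
  maximally_monotone ip (op_map (fun x => c + S x)).
Proof.
move=> SB Sskew; split=> [x y _ _ -> ->|B Bmono sub x v Bxv].
  by rewrite opprD addrACA subrr add0r -SB Sskew.
set h := v - (c + S x).
have := Bmono _ _ _ _ Bxv (sub (x + h) _ erefl).
have -> : x - (x + h) = - h by rewrite opprD addNKr.
have -> : v - (c + S (x + h)) = h - S h.
  have -> : S h = S (x + h) - S x by rewrite -SB [x + h]addrC addrK.
  by move: (S (x + h)) => s; rewrite /h opprB !opprD !addrA subrK.
rewrite ipNl ipDr ipNr Sskew subr0 oppr_ge0 => /ip_le0 /eqP.
by rewrite subr_eq0 => /eqP.
Qed.

Lemma const_maximal (c : H) : maximally_monotone ip (op_map (fun=> c)).
Proof.
have -> : (fun=> c) = (fun x : H => c + (fun=> 0) x).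
  by apply: funext => x; rewrite addr0.
apply: skew_affine_maximal => [x y|x]; first by rewrite subr0.
by rewrite ipC ip0l.
Qed.

(** The rotation [u |-> <r, u> e - <e, u> r] in the plane of [r] and [e] maps
    [r] to [0] only if [e] is a multiple of [r], and this cannot be so for both
    of two independent vectors [e]. *)
Lemma exists_skew (r : H) : dim_ge2 H -> r <> 0 ->
  exists S : H -> H, [/\ forall x y, S (x - y) = S x - S y,
    forall x, ip x (S x) = 0 & S r <> 0].
Proof.
move=> [x [y xy_free]] r0.
pose S e u := ip r u *: e - ip e u *: r.
have [e Se] : exists e, S e r <> 0.
  apply: contrapT => /forallNP S0.
  have ort e : e = (ip r r)^-1 * ip e r *: r.
    have /contrapT/eqP := S0 e; rewrite subr_eq0 => /eqP er.
    rewrite -scalerA -er scalerA mulVf ?scale1r //.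
    by apply/eqP => rr; apply: r0; apply: ip_le0; rewrite rr.
  set a := (ip r r)^-1 * ip x r in ort *.
  set b := (ip r r)^-1 * ip y r.
  have [_ /eqP] : b = 0 /\ - a = 0.
    apply: xy_free; rewrite (ort x) (ort y) !scalerA mulrC mulNr -scalerDl.
    by rewrite subrr scale0r.
  rewrite oppr_eq0 => /eqP a0.
  have [] := xy_free 1 0; last by move/eqP; rewrite oner_eq0.
  by rewrite scale1r (ort x) -/a a0 !scale0r addr0.
exists (S e); split=> // [u v|u].
  by rewrite /S !ipDr !ipNr !scalerBl !opprD addrACA.
by rewrite /S ipDr ipNr !ipZr (ipC u r) (ipC u e) mulrC subrr.
Qed.

End Monotone.

(** * Matrices acting on powers of the space *)

Section MatrixAction.
Context (R : realType) (H : lmodType R).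

Lemma mxopM (k m l : nat) (B : 'M[R]_(k, m)) (C : 'M[R]_(m, l))
    (z : 'I_l -> H) : mxop (B *m C) z = mxop B (mxop C z).
Proof.
apply: funext => i; rewrite /mxop.
under eq_bigr => j _ do rewrite mxE scaler_suml.
rewrite exchange_big; apply: eq_bigr => j _; rewrite scaler_sumr.
by apply: eq_bigr => a _; rewrite scalerA.
Qed.

Lemma mxopD (k m : nat) (B C : 'M[R]_(k, m)) (z : 'I_m -> H) :
  mxop (B + C) z = mxop B z + mxop C z.
Proof.
apply: funext => i; rewrite -[RHS]/(mxop B z i + mxop C z i) /mxop -big_split.
by apply: eq_bigr => j _; rewrite mxE scalerDl.
Qed.

Lemma mxopZ (k m : nat) (a : R) (B : 'M[R]_(k, m)) (z : 'I_m -> H) :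
  mxop (a *: B) z = a *: mxop B z.
Proof.
apply: funext => i; rewrite -[RHS]/(a *: mxop B z i) /mxop scaler_sumr.
by apply: eq_bigr => j _; rewrite mxE scalerA.
Qed.

Lemma mxopN (k m : nat) (B : 'M[R]_(k, m)) (z : 'I_m -> H) :
  mxop (- B) z = - mxop B z.
Proof. by rewrite -scaleN1r mxopZ scaleN1r. Qed.

Lemma mxop_addr (k m : nat) (B : 'M[R]_(k, m)) (z w : 'I_m -> H) :
  mxop B (z + w) = mxop B z + mxop B w.
Proof.
apply: funext => i; rewrite -[RHS]/(mxop B z i + mxop B w i) /mxop -big_split.
by apply: eq_bigr => j _; exact: scalerDr.
Qed.

Lemma mxop0 (k m : nat) (B : 'M[R]_(k, m)) : mxop B (0 : 'I_m -> H) = 0.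
Proof. by apply: funext => i; apply: big1 => j _; rewrite scaler0. Qed.

Lemma mxop1 (m : nat) (z : 'I_m -> H) : mxop 1%:M z = z.
Proof.
apply: funext => i; rewrite /mxop (bigD1 i) //= big1 ?addr0.
  by rewrite mxE eqxx scale1r.
by move=> j ji; rewrite mxE eq_sym (negPf ji) scale0r.
Qed.

Lemma mxop_row_mx (k m l : nat) (B : 'M[R]_(k, m)) (C : 'M[R]_(k, l))
    (z : 'I_(m + l) -> H) :
  mxop (row_mx B C) z =
  mxop B (fun i => z (lshift l i)) + mxop C (fun i => z (rshift m i)).
Proof.
apply: funext => i; rewrite -[RHS]/(mxop B _ i + mxop C _ i).
rewrite /mxop big_split_ord.
by congr (_ + _); apply: eq_bigr => j _; rewrite ?row_mxEl ?row_mxEr.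
Qed.

Lemma mxop_col1 (k : nat) (C : 'M[R]_(k, 1)) (w : H) i :
  mxop C (fun=> w) i = C i ord0 *: w.
Proof. by rewrite /mxop big_ord1. Qed.

End MatrixAction.

(** * The primal-dual inclusion, row by row *)

Section PrimalDual.
Context (R : realType) (H : completeNormedModType R).
Context (ip : {dot H for (@idfun R)}) (n : nat) (F : {set 'I_n}).
Implicit Types (A : op_tuple ip F) (p : 'I_n).

Lemma GammaE p i j : Gamma p i j = (i == p)%:R - (j == p)%:R :> R.
Proof. by rewrite !mxE. Qed.

Lemma mxop_Gamma p (y : 'I_n -> H) i :
  mxop (Gamma p) y i = if i == p then \sum_(j | j != p) y j else - y p.
Proof.
have -> : mxop (Gamma p) y i = (i == p)%:R *: (\sum_j y j) - y p.
  rewrite /mxop; under eq_bigr => j _ do rewrite GammaE scalerBl.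
  rewrite sumrB scaler_sumr; congr (_ - _).
  rewrite (bigD1 p) //= eqxx scale1r big1 ?addr0 // => j jp.
  by rewrite (negPf jp) scale0r.
case: eqP => _; last by rewrite scale0r add0r.
by rewrite scale1r (bigD1 p) //= addrAC subrr add0r.
Qed.

Lemma resolvent_PhiE A p (M : 'M[R]_n) (v y : 'I_n -> H) :
  op_inv (op_add (op_map (mxop M)) (Phi A p)) v y <->
  forall i, hat_op A p i (y i) (v i - mxop (M + Gamma p) y i).
Proof.
rewrite mxopD; split=> [[_ -> [_ [u hu [_ -> <-]] <-]] i|hy].
  rewrite !fctE [X in hat_op _ _ _ _ X](_ : _ = u i) //.
  by rewrite addrCA addrK.
exists (mxop M y) => //; exists (v - mxop M y); last by rewrite addrC subrK.
exists (v - (mxop M y + mxop (Gamma p) y)) => //.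
by exists (mxop (Gamma p) y) => //; rewrite opprD addrA subrK.
Qed.

(** A zero [x] with values [u i] summing to zero corresponds to the vector [y]
    holding the primal point [x] in row [p] and the dual values [u i] in the
    other rows. *)
Lemma zer_op_sumE A p (x : H) :
  zer (op_sum A) x <-> exists y : 'I_n -> H,
    y p = x /\ forall i, hat_op A p i (y i) (- mxop (Gamma p) y i).
Proof.
rewrite /hat_op; split=> [[u Au u0]|[y [<- hy]]].
  exists (fun i => if i == p then x else u i); rewrite eqxx; split=> // i.
  rewrite mxop_Gamma eqxx; case: eqP => [->|ip_neq]; last first.
    by rewrite /op_inv /= opprK; exact: Au.
  have -> : - \sum_(j | j != p) (if j == p then x else u j) = u p.
    apply/eqP; rewrite eq_sym -addr_eq0; apply/eqP.
    rewrite -[RHS]u0 [RHS](bigD1 p) //=; congr (_ + _).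
    by apply: eq_bigr => j /negPf ->.
  exact: Au.
exists (fun i => if i == p then - \sum_(j | j != p) y j else y i).
  move=> i /=; have := hy i; rewrite mxop_Gamma; case: eqP => [->|_] //.
  by rewrite /op_inv /= opprK.
rewrite (bigD1 p) //= eqxx.
by rewrite [X in _ + X](eq_bigr y) ?addNr // => j /negPf ->.
Qed.

End PrimalDual.

(** * Steps and rows as a change of unknown *)

(** For an evaluation with argument [q], value [w] and step size [g], the
    coefficients below express the row as [arg_coef * q - diag_coef * y], an
    element of [hat_op] at [y], and the value as
    [w = out_arg * q + out_val * y].  In row [p] the unknown [y] is the value of
    the resolvent; for a single-valued operator it is the value of the operator;
    otherwise it is the element [(q - w) / g] of [A w], so that the row is the
    Moreau decomposition of [q]. *)

Section StepCoefficients.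
Context (R : realType) (n : nat) (F : {set 'I_n}) (p : 'I_n).

Definition arg_coef (i : 'I_n) (g : R) : R := if i == p then g^-1 else 1.

Definition diag_coef (i : 'I_n) (g : R) : R :=
  if i \in F then 0 else if i == p then g^-1 else g.

Definition out_arg (i : 'I_n) : R := ((i \notin F) && (i != p))%:R.

Definition out_val (i : 'I_n) (g : R) : R :=
  if (i \notin F) && (i != p) then - g else 1.

Lemma out_val_neq0 i g : 0 < g -> out_val i g != 0.
Proof.
by rewrite /out_val; case: ifP; rewrite ?oppr_eq0 ?oner_eq0 // => _ /gt_eqF ->.
Qed.

Lemma arg_coef_neq0 i g : 0 < g -> arg_coef i g != 0.
Proof.
by rewrite /arg_coef; case: ifP; rewrite ?invr_eq0 ?oner_eq0 // => _ /gt_eqF ->.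
Qed.

Context (H : completeNormedModType R) (ip : {dot H for (@idfun R)}).

Lemma resolventE (A : H -> set H) (g : R) (q w : H) : 0 < g ->
  resolvent (op_scale g A) q w <-> A w (g^-1 *: (q - w)).
Proof.
move=> g0; have g_neq0 : g != 0 by rewrite gt_eqF.
split=> [[_ -> [_ [v Av <-] <-]]|Aw].
  by rewrite addrC addKr scalerA mulVf // scale1r.
exists w => //; exists (q - w); last by rewrite addrC subrK.
by exists (g^-1 *: (q - w)) => //; rewrite scalerA mulfV // scale1r.
Qed.

Lemma hat_op_step (A : op_tuple ip F) i (g : R) (q y : H) :
  p \notin F -> 0 < g ->
  hat_op A p i y (arg_coef i g *: q - diag_coef i g *: y) <->
  step_op A i g q (out_arg i *: q + out_val i g *: y).
Proof.
move=> pF g0; have g_neq0 : g != 0 by rewrite gt_eqF.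
rewrite /hat_op /step_op /arg_coef /diag_coef /out_arg /out_val.
have [->|ip_neq] := eqVneq i p.
  rewrite (negPf pF) /= scale0r add0r scale1r -scalerBr.
  by rewrite resolventE.
case: ifP => iF /=; rewrite !scale1r ?scale0r ?subr0 ?add0r //.
rewrite resolventE // scaleNr opprB [g *: y + _]addrC addNKr.
by rewrite scalerA mulVf // scale1r.
Qed.

End StepCoefficients.
Arguments out_arg {R n} F p i.

(** * From a composition of steps to a primal-dual resolvent *)

(** The state [zs k] of a composition of steps [x |-> B x + C w] with
    [w = s (D x) + t y_k] depends linearly on the initial state and on the
    vector [y]; [trace_in] and [trace_val] are the two coefficient matrices. *)

Section Trace.
Context (R : realType) (n : nat) (ds : nat -> nat).
Context (B : forall k, 'M[R]_(ds k.+1, ds k)) (C : forall k, 'M[R]_(ds k.+1, 1)).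
Context (D : forall k, 'M[R]_(1, ds k)) (s t : nat -> R).

Fixpoint trace_in k : 'M[R]_(ds k, ds 0%N) :=
  if k is k'.+1 then (B k' + s k' *: (C k' *m D k')) *m trace_in k' else 1%:M.

Fixpoint trace_val k : 'M[R]_(ds k, n) :=
  if k is k'.+1 then
    (B k' + s k' *: (C k' *m D k')) *m trace_val k' +
    t k' *: (C k' *m \row_j (j == k' :> nat)%:R)
  else 0.

(** Causality: this is what makes the system of the arguments triangular. *)
Lemma trace_val_eq0 k i (j : 'I_n) : (k <= j)%N -> trace_val k i j = 0.
Proof.
elim: k i => [|k IHk] i kj /=; first by rewrite mxE.
rewrite mxE mxE big1 => [|a _]; last by rewrite IHk ?mulr0 // ltnW.
by rewrite !mxE big_ord1 mxE gtn_eqF // !mulr0 addr0.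
Qed.

Context (H : lmodType R).

(** The recursion is only assumed below [k], so that this applies to a vector
    [y] of which only the first [k] entries are known. *)
Lemma traceE (z : 'I_(ds 0%N) -> H) (y : 'I_n -> H)
    (zs : forall k, 'I_(ds k) -> H) k :
  (k <= n)%N -> zs 0%N = z ->
  (forall i : 'I_n, (i < k)%N ->
     zs i.+1 = mxop (B i) (zs i) +
       mxop (C i) (fun=> s i *: mxop (D i) (zs i) ord0 + t i *: y i)) ->
  zs k = mxop (trace_in k) z + mxop (trace_val k) y.
Proof.
move=> kn z0; elim: k kn => [|k IHk] kn zsS.
  rewrite z0 /= mxop1 [X in _ + X](_ : _ = 0) ?addr0 //.
  by apply: funext => i; apply: big1 => j _; rewrite mxE scale0r.
have zk : zs k = mxop (trace_in k) z + mxop (trace_val k) y.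
  by apply: IHk => [|i ik]; [exact: ltnW|apply: zsS; exact: ltnW].
rewrite /= (zsS (Ordinal kn)) //= mxopD addrA !mxopM -mxop_addr -zk.
rewrite mxopD mxopZ mxopZ !mxopM -addrA; congr (_ + _).
apply: funext => i; rewrite mxop_col1 scalerDr.
congr (_ + _); rewrite scalerA mulrC -scalerA; congr (_ *: _).
  by rewrite /mxop big_ord1.
rewrite [RHS]/mxop big_ord1; congr (_ *: _).
rewrite /mxop (bigD1 (Ordinal kn)) //= mxE eqxx scale1r big1 ?addr0 // => j jk.
by rewrite mxE [_ == _ :> nat](negPf jk) scale0r.
Qed.

End Trace.

Section Necessity.
Context (R : realType) (H : completeNormedModType R).
Context (ip : {dot H for (@idfun R)}) (n d : nat) (F : {set 'I_n}).
Context (p : 'I_n) (T : op_tuple ip F -> ('I_d -> H) -> ('I_d -> H)).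

(** The solution of the inclusion at [z] is read off the run of the composition
    from [z]; it is unique because, row after row, the entries of any solution
    are forced by the single values of the steps. *)
Lemma frugal_primal_dual_resolvent : p \notin F ->
  frugal_splitting_operator T ->
  exists (M : 'M[R]_n) (N : 'M[R]_(n, d)) (U : 'M[R]_d) (V : 'M[R]_(d, n)),
    generalized_primal_dual_resolvent T p M N U V /\ p_kernel F p M.
Proof.
move=> pF [ds [e0 [en [tau [_ _ TE steps]]]]]; subst d.
(* The data are chosen for every natural index, with dummies from [n] on,
   because the dimensions are indexed by natural numbers. *)
have {steps}stepsE (i : nat) : exists st : 'M[R]_(ds i.+1, ds i) *
    'M[R]_(ds i.+1, 1) * 'M[R]_(1, ds i) * R, 0 < st.2 /\
    (forall j : 'I_n, j = i :> nat -> forall A z, exists w : H,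
      step_op A j st.2 (mxop st.1.2 z ord0) = [set w] /\
      tau i A z = mxop st.1.1.1 z + mxop st.1.1.2 (fun=> w)).
  have [i_lt|i_ge] := ltnP i n; last first.
    exists (0, 0, 0, 1); split=> // j ji.
    by have := ltn_ord j; rewrite ji ltnNge i_ge.
  have [B [C [D [g [g0 BCD]]]]] := steps (Ordinal i_lt).
  exists (B, C, D, g); split=> // j ji A z.
  by rewrite (_ : j = Ordinal i_lt) //; exact: val_inj.
pose st i := sval (cid (stepsE i)).
pose B i := (st i).1.1.1; pose C i := (st i).1.1.2; pose D i := (st i).1.2.
pose g i := (st i).2.
have g0 i : 0 < g i by have [] := svalP (cid (stepsE i)).
have stepsP (i : 'I_n) A z : exists w : H,
    step_op A i (g i) (mxop (D i) z ord0) = [set w] /\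
    tau i A z = mxop (B i) z + mxop (C i) (fun=> w).
  by have [_ /(_ i erefl A z)] := svalP (cid (stepsE i)).
pose s k := out_arg F p (insubd p k) : R.
pose t k := out_val F p (insubd p k) (g k).
pose E := trace_in B C D s; pose G := trace_val n B C D s t.
pose L := \matrix_(i < n, j < n) (diag_coef F p i (g i) *+ (i == j)
   - arg_coef p i (g i) * (D i *m G i) ord0 j).
pose N := \matrix_(i < n, j < ds 0%N)
   (arg_coef p i (g i) * (D i *m E i) ord0 j).
pose U := 1%:M - \matrix_(i, j) E n (cast_ord (esym en) i) j.
pose V := \matrix_(i, j) G n (cast_ord (esym en) i) j.
have DG0 (i j : 'I_n) : (i <= j)%N -> (D i *m G i) ord0 j = 0.
  by move=> ij; rewrite mxE big1 // => a _; rewrite trace_val_eq0 ?mulr0.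
exists (L - Gamma p), N, U, V; split; last first.
  have Lii i : (L - Gamma p) i i = diag_coef F p i (g i).
    by rewrite mxE mxE eqxx DG0 // mulr0 subr0 mxE GammaE subrr subr0.
  split=> // [|i|i].
  - rewrite subrK; apply/is_trig_mxP => i j ij.
    by rewrite mxE DG0 ?(ltnW ij) // mulr0 subr0 -val_eqE ltn_eqF.
  - rewrite Lii /diag_coef; do 2?case: ifP => // _; last exact: ltW.
    by rewrite invr_ge0 ltW.
  - rewrite Lii /diag_coef; case: ifP => // _; split=> // /eqP.
    by case: ifP => _; rewrite ?invr_eq0 gt_eqF.
move=> A z.
pose zs k := @compose_steps R H ds (tau ^~ A) k z.
pose q (i : 'I_n) := mxop (D i) (zs i) ord0.
have /choice [w wP] (i : 'I_n) : exists w : H,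
    step_op A i (g i) (q i) = [set w] /\
    zs i.+1 = mxop (B i) (zs i) + mxop (C i) (fun=> w).
  exact: stepsP.
(* The equation of row [i], expressed through the argument of step [i]. *)
have rowE (y : 'I_n -> H) (i : 'I_n) :
    zs i = mxop (E i) z + mxop (G i) y ->
    mxop N z i - mxop L y i =
    arg_coef p i (g i) *: q i - diag_coef F p i (g i) *: y i.
  move=> ziE.
  have NE : mxop N z i = arg_coef p i (g i) *: mxop (D i *m E i) z ord0.
    rewrite /mxop scaler_sumr; apply: eq_bigr => j _.
    by rewrite mxE scalerA.
  have LE : mxop L y i = diag_coef F p i (g i) *: y i -
      arg_coef p i (g i) *: mxop (D i *m G i) y ord0.
    rewrite /mxop scaler_sumr.
    rewrite -[X in X - _](_ : \sum_j (diag_coef F p i (g i) *+ (i == j)) *: y j = _).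
      by rewrite -sumrB; apply: eq_bigr => j _; rewrite mxE scalerBl scalerA.
    rewrite (bigD1 i) //= eqxx big1 ?addr0 // => j ji.
    by rewrite eq_sym (negPf ji) scale0r.
  rewrite NE LE !mxopM opprB addrA; congr (_ - _).
  by rewrite /q ziE mxop_addr [X in _ = _ *: X]/(_ + _) -scalerDr.
pose y i := (out_val F p i (g i))^-1 *: (w i - out_arg F p i *: q i).
have yE (v : 'I_n -> H) i :
    out_arg F p i *: q i + out_val F p i (g i) *: v i = w i <-> v i = y i.
  have t0 := out_val_neq0 F p i (g0 i).
  rewrite /y; split=> [<-|->]; last first.
    by rewrite scalerA mulfV // scale1r addrC subrK.
  by rewrite [_ *: q i + _]addrC addrK scalerA mulVf // scale1r.
have zsE v k : (k <= n)%N -> (forall i : 'I_n, (i < k)%N -> v i = y i) ->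
    zs k = mxop (E k) z + mxop (G k) v.
  move=> kn vy; apply: traceE => // i ik.
  by rewrite (wP i).2 /s /t !valKd -[w i]((yE v i).2 (vy i ik)).
exists y; split; last first.
  apply: funext => i; rewrite TE /pow_cast.
  rewrite [X in compose_steps _ X](_ : _ = z); last first.
    by apply: funext => j; congr z; exact: val_inj.
  rewrite -/(zs n) (zsE y n) //.
  rewrite mxopD mxop1 mxopN opprD addrA subrr add0r opprK.
  by congr (_ + _); apply: eq_bigr => j _; rewrite mxE.
apply/seteqP; split=> v /=; last first.
  move=> ->; apply/resolvent_PhiE => i.
  rewrite subrK rowE; last exact: zsE (ltnW (ltn_ord i)) _.
  by apply/hat_op_step => //; rewrite (wP i).1; apply/yE.
move=> /resolvent_PhiE; rewrite subrK => hv.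
suff vy k : (k <= n)%N -> forall i : 'I_n, (i < k)%N -> v i = y i.
  by apply: funext => i; exact: (vy n).
elim: k => // k IHk kn i; rewrite ltnS leq_eqVlt => /orP[/eqP ik|]; last first.
  exact/IHk/ltnW.
apply/yE; have := hv i; rewrite rowE; last first.
  by apply: zsE; rewrite ik; [exact: ltnW|apply: IHk; exact: ltnW].
by move=> /hat_op_step -/(_ pF (g0 i)); rewrite (wP i).1.
Qed.

End Necessity.

(** * Fixed points, zeros and the kernel and range conditions *)

Section FixedPointConditions.
Context (R : realType) (H : completeNormedModType R).
Context (ip : {dot H for (@idfun R)}) (n d : nat) (F : {set 'I_n}).
Context (p : 'I_n) (T : op_tuple ip F -> ('I_d -> H) -> ('I_d -> H)).
Context (M : 'M[R]_n) (N : 'M[R]_(n, d)) (U : 'M[R]_d) (V : 'M[R]_(d, n)).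
Context (TE : generalized_primal_dual_resolvent T p M N U V).

Lemma resolvent_fixed_point (A : op_tuple ip F) (z : 'I_d -> H) :
  T A z = z <-> exists y : 'I_n -> H, mxop U z = mxop V y /\
    forall i, hat_op A p i (y i) (mxop N z i - mxop (M + Gamma p) y i).
Proof.
have [y [yE ->]] := TE A z; split=> [/eqP|[v [Uz hv]]].
  rewrite -subr_eq0 addrAC [z - _]addrC addrK addrC subr_eq0 => /eqP Uz.
  exists y; split=> //; apply/resolvent_PhiE.
  by rewrite yE.
have : op_inv (op_add (op_map (mxop M)) (Phi A p)) (mxop N z) v.
  exact/resolvent_PhiE.
by rewrite yE => <-; rewrite Uz subrK.
Qed.

(** Affine operators with the linear parts [S i], through the points prescribed
    by the rows of the inclusion, make [(z, y)] a fixed point whatever the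
    residual [r] is; a zero of their sum is then a zero of an affine map, written
    here with the origin moved to [y p]. *)
Lemma zero_of_fixed_points (z : 'I_d -> H) (y : 'I_n -> H)
    (S : 'I_n -> H -> H) (r := mxop N z - mxop M y) :
  (forall A, fix_set (T A) !=set0 -> zer (op_sum A) !=set0) ->
  mxop U z = mxop V y ->
  (forall i x x', S i (x - x') = S i x - S i x') ->
  (forall i x, ip x (S i x) = 0) ->
  exists x, r p + \sum_i S i (x - (if i == p then 0 else r i)) = 0.
Proof.
move=> fix_zer Uz SB Sskew.
pose u i := mxop N z i - mxop (M + Gamma p) y i.
have uE i : u i = if i == p then r p - \sum_(j | j != p) y j else r i + y p.
  rewrite /u mxopD [(mxop M y + _) i]/(mxop M y i + _) opprD addrA mxop_Gamma.
  by case: eqP => [->|_] //; rewrite opprK.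
pose a i := if i == p then y i else u i.
pose b i := if i == p then u i else y i.
pose A := OpTuple (F := F)
  (fun i => skew_affine_maximal (b i - S i (a i)) (SB i) (Sskew i))
  (fun i _ x => ex_intro _ _ erefl).
have AE i x v : A i x v <-> v = b i + S i (x - a i).
  rewrite SB addrA addrAC; exact: iff_refl.
have [|x [w Aw w0]] := fix_zer A.
  exists z; apply/resolvent_fixed_point; exists y; split=> // i.
  rewrite -/(u i) /hat_op; case: eqP => ip_eq; last first.
    apply/AE; rewrite /a /b; move/eqP: ip_eq => /negPf ->.
    by rewrite subrr -(subrr 0) SB !subrr addr0.
  by apply/AE; rewrite /a /b ip_eq eqxx subrr -(subrr 0) SB !subrr addr0.
exists (x - y p); rewrite -[RHS]w0.
have bp : r p = \sum_i b i.
  rewrite (bigD1 p) //= /b eqxx uE eqxx.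
  by rewrite [X in _ + X](eq_bigr y) ?subrK // => j /negPf ->.
rewrite bp -big_split; apply: eq_bigr => i _; have /AE -> := Aw i.
congr (_ + S i _); rewrite /a uE; case: eqP => [->|_]; first by rewrite subr0.
by rewrite -addrA -opprD [y p + _]addrC.
Qed.

(** Constant operators, whose sum is [r p], force [r p = 0].  If [r i <> 0] for
    some other [i], take [- S] in row [p] and [S] in row [i] with [S] skew and
    [S (r i) <> 0]: the sum of the operators is the constant [- S (r i)], which
    has no zero. *)
Lemma fixed_point_ker : dim_ge2 H ->
  (forall A, fix_set (T A) !=set0 -> zer (op_sum A) !=set0) ->
  @ker_mx R H _ _ (row_mx U (- V)) `<=` @ker_mx R H _ _ (row_mx N (- M)).
Proof.
move=> H_dim fix_zer x; rewrite /ker_mx /= !mxop_row_mx !mxopN.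
set z := fun i => x (lshift n i); set y := fun i => x (rshift d i).
move=> /eqP; rewrite subr_eq0 => /eqP Uz.
set r := mxop N z - mxop M y.
have rp : r p = 0.
  have [] := @zero_of_fixed_points z y (fun _ _ => 0) fix_zer Uz.
  - by move=> i v w; rewrite subrr.
  - by move=> i v; rewrite ipC ip0l.
  by move=> v; rewrite big1 // addr0.
suff r0 i : r i = 0 by exact: funext r0.
apply: contrapT => ri_neq0.
have ip_neq : i != p by apply/eqP => ip_eq; apply: ri_neq0; rewrite ip_eq.
have [S [SB Sskew Sr]] := exists_skew ip H_dim ri_neq0.
have S0 : S 0 = 0 by rewrite -(subrr 0) SB !subrr.
pose SS j x := if j == p then - S x else if j == i then S x else 0.
have [] := @zero_of_fixed_points z y SS fix_zer Uz.
- move=> j v w; rewrite /SS; case: ifP => _; first by rewrite SB opprD.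
  by case: ifP => _; rewrite ?SB ?subrr.
- move=> j v; rewrite /SS; case: ifP => _; first by rewrite ipNr Sskew oppr0.
  by case: ifP => _ //; rewrite ipC ip0l.
move=> v; rewrite -/r rp add0r (bigD1 p) //= (bigD1 i) //= big1; last first.
  by move=> j /andP[/negPf jp /negPf ji]; rewrite /SS jp ji.
rewrite /SS eqxx (negPf ip_neq) eqxx subr0 addr0 SB addKr => /eqP.
by rewrite oppr_eq0 => /eqP.
Qed.

(** The normal cone of [y p] in row [p] and the constants [y i] elsewhere admit
    [y] as the only solution of the inclusion, whatever its right-hand side, and
    their sum has the zero [y p]. *)
Lemma fixed_point_ran : p \notin F ->
  (forall A : op_tuple ip F, zer (op_sum A) !=set0 -> fix_set (T A) !=set0) ->
  @ran_mx R H _ _ V `<=` @ran_mx R H _ _ U.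
Proof.
move=> pF zer_fix _ [y _ <-].
pose Aop i := if i == p then point_cone (y p) else op_map (fun=> y i).
have Amax i : maximally_monotone ip (Aop i).
  by rewrite /Aop; case: ifP => _; [exact: point_cone_maximal|exact: const_maximal].
have Asing i : i \in F -> single_valued (Aop i).
  rewrite /Aop; case: eqP => [->|_ _ x]; first by rewrite (negPf pF).
  by exists (y i).
pose A := OpTuple Amax Asing.
have hatE v i w : hat_op A p i (v i) w <-> v i = y i.
  rewrite /hat_op /= /Aop; case: eqP => [->|_]; first exact: iff_refl.
  exact: iff_refl.
have [|z /resolvent_fixed_point[v [Uz hv]]] := zer_fix A.
  by exists (y p); apply/(zer_op_sumE A p); exists y; split=> // i; apply/hatE.
exists z => //; rewrite Uz; congr mxop; apply: funext => i.
by apply/(hatE v i); exact: hv.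
Qed.

Lemma fixed_points_iff_zeros :
  @ker_mx R H _ _ (row_mx U (- V)) `<=` @ker_mx R H _ _ (row_mx N (- M)) ->
  @ran_mx R H _ _ V `<=` @ran_mx R H _ _ U ->
  forall A, fix_set (T A) !=set0 <-> zer (op_sum A) !=set0.
Proof.
move=> kerUV ranVU A.
have NM (z : 'I_d -> H) (y : 'I_n -> H) i : mxop U z = mxop V y ->
    mxop N z i - mxop (M + Gamma p) y i = - mxop (Gamma p) y i.
  move=> Uz; pose x := fun j : 'I_(d + n) =>
    match fintype.split j with inl a => z a | inr b => y b end.
  have xl : (fun a => x (lshift n a)) = z.
    by apply: funext => a; rewrite /x (unsplitK (inl a)).
  have xr : (fun a => x (rshift d a)) = y.
    by apply: funext => a; rewrite /x (unsplitK (inr a)).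
  have := kerUV x; rewrite /ker_mx /= !mxop_row_mx !mxopN xl xr Uz subrr.
  move=> /(_ erefl) /eqP; rewrite subr_eq0 => /eqP ->.
  by rewrite mxopD [(mxop M y + _) i]/(mxop M y i + _) opprD addrA subrr add0r.
split=> [[z /resolvent_fixed_point[y [Uz hy]]]|[x /(zer_op_sumE A p)[y [_ hy]]]].
  by exists (y p); apply/(zer_op_sumE A p); exists y; split=> // i; rewrite -(NM z).
have [z _ Uz] : ran_mx U (mxop V y) by apply: ranVU; exists y.
exists z; apply/resolvent_fixed_point; exists y; split=> // i.
by rewrite NM.
Qed.

End FixedPointConditions.

(** * From a primal-dual resolvent to a composition of steps *)

Section Inclusion.
Context (R : realType) (H : lmodType R).

(** Truncation to the first [k] coordinates, or padding by zeros, according to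
    which of the two dimensions is larger. *)
Definition incl_mx (k m : nat) : 'M[R]_(k, m) :=
  \matrix_(i, j) (i == j :> nat)%:R.

Lemma mxop_incl k m (v : 'I_m -> H) (i : 'I_k) (j : 'I_m) :
  i = j :> nat -> mxop (incl_mx k m) v i = v j.
Proof.
move=> ij; rewrite /mxop (bigD1 j) //= mxE ij eqxx scale1r big1 ?addr0 // => a aj.
by rewrite mxE ij eq_sym [_ == _ :> nat](negPf aj) scale0r.
Qed.

Lemma mxop_incl_out k m (v : 'I_m -> H) (i : 'I_k) :
  (m <= i)%N -> mxop (incl_mx k m) v i = 0.
Proof.
move=> mi; apply: big1 => j _; rewrite mxE gtn_eqF ?scale0r //.
exact: leq_trans (ltn_ord j) mi.
Qed.

Lemma mxop_inclK k m (v : 'I_k -> H) : (k <= m)%N ->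
  mxop (incl_mx k m) (mxop (incl_mx m k) v) = v.
Proof.
move=> km; apply: funext => i.
by rewrite (@mxop_incl _ _ _ i (widen_ord km i)) // (@mxop_incl _ _ _ _ i).
Qed.

End Inclusion.

Section Sufficiency.
Context (R : realType) (H : completeNormedModType R).
Context (ip : {dot H for (@idfun R)}) (n d : nat) (F : {set 'I_n}).
Context (p : 'I_n) (T : op_tuple ip F -> ('I_d -> H) -> ('I_d -> H)).
Context (M : 'M[R]_n) (N : 'M[R]_(n, d)) (U : 'M[R]_d) (V : 'M[R]_(d, n)).
Context (TE : generalized_primal_dual_resolvent T p M N U V).
Context (Mker : p_kernel F p M).

(** The step sizes for which [diag_coef] is the diagonal of the kernel; an
    evaluation of a single-valued operator has none, and 1 is a dummy. *)
Definition step_size (i : 'I_n) : R :=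
  if i \in F then 1 else if i == p then (M i i)^-1 else M i i.

Lemma step_size_gt0 i : 0 < step_size i.
Proof.
rewrite /step_size; case: ifPn => // iF.
have Mi : 0 < M i i.
  have [_ _ M_ge0 M_eq0] := Mker; rewrite lt_neqAle M_ge0 andbT eq_sym.
  by apply/eqP => /M_eq0; rewrite (negPf iF).
by case: ifP; rewrite ?invr_gt0.
Qed.

Lemma diag_step_size i : diag_coef F p i (step_size i) = M i i.
Proof.
rewrite /diag_coef /step_size; have [_ _ _ M_eq0] := Mker.
case: (boolP (i \in F)) => [iF|_]; first by rewrite (M_eq0 i).2.
by case: (i == p); rewrite /= ?invrK.
Qed.

Lemma maximally_monotone_shift (A : H -> set H) (q : H) :
  maximally_monotone ip A -> maximally_monotone ip (fun u => A (u + q)).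
Proof.
move=> [Amono Amax]; split=> [x y u v Axu Ayv|B Bmono AB x].
  by have := Amono _ _ _ _ Axu Ayv; rewrite opprD addrACA subrr addr0.
have := Amax (fun u => B (u - q)) _ _ (x + q).
rewrite addrK; apply=> [a b u v Bau Bbv|a].
  by have := Bmono _ _ _ _ Bau Bbv; rewrite opprB addrA subrK.
by have := AB (a - q); rewrite subrK.
Qed.

(** Translating [A i] by [q] reduces the point [q] to the point [0].  There the
    resolvent of the kernel, at the input [0], is tested on the tuple that has
    the translate in row [i] and, elsewhere, constants [0] and the normal cone
    of [0]: its single solution vanishes outside row [i], and its entry in this
    row is the only solution of the inclusion that defines the step. *)
Lemma step_op_single (A : op_tuple ip F) i (q : H) :
  exists w, step_op A i (step_size i) q = [set w].
Proof.
have [pF _ _ _] := Mker; have g0 := step_size_gt0 i.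
case: (boolP (i \in F)) => iF; first by rewrite /step_op iF; exact: op_of_single.
pose Aop j := if j == i then (fun u => A i (u + q)) else
  if j == p then point_cone (0 : H) else op_map (fun=> 0).
have Amax j : maximally_monotone ip (Aop j).
  rewrite /Aop; case: ifP => _.
    exact/maximally_monotone_shift/op_of_maximal.
  by case: ifP => _; [exact: point_cone_maximal|exact: const_maximal].
have Asing j : j \in F -> single_valued (Aop j).
  rewrite /Aop; case: eqP => [->|_]; first by rewrite (negPf iF).
  by case: eqP => [->|_ _ x]; [rewrite (negPf pF)|exists 0].
pose A' := OpTuple Amax Asing.
have hat0 j v u : j != i -> hat_op A' p j v u <-> v = 0.
  rewrite /hat_op /= /Aop => /negPf ->.
  by case: eqP => _; exact: iff_refl.
(* With zeros in the other entries, row [i] is an inclusion in [v i] alone. *)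
have rowi (v : 'I_n -> H) : (forall j, j != i -> v j = 0) ->
    mxop (M + Gamma p) v i = M i i *: v i.
  move=> v0; rewrite /mxop (bigD1 i) //= big1 => [|j ji].
    by rewrite mxE GammaE subrr !addr0.
  by rewrite v0 // scaler0.
have stepE v : step_op A i (step_size i) q (out_val F p i (step_size i) *: v + q)
    <-> hat_op A' p i v (- (M i i *: v)).
  have := hat_op_step A' i 0 v pF g0.
  rewrite !scaler0 !add0r diag_step_size => ->.
  rewrite /step_op (negPf iF) !resolventE // /= /Aop eqxx.
  by rewrite opprD addrCA subrr addr0 sub0r.
have [y [yE _]] := TE A' 0; rewrite mxop0 in yE.
have t0 : out_val F p i (step_size i) != 0 by exact: out_val_neq0.
exists (out_val F p i (step_size i) *: y i + q).
apply/seteqP; split=> [w|_ ->]; last first.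
  have /resolvent_PhiE yP : op_inv (op_add (op_map (mxop M)) (Phi A' p)) 0 y.
    by rewrite yE.
  apply/stepE; have := yP i; rewrite sub0r rowi // => j ji.
  by have /hat0 := yP j; exact.
pose v := (out_val F p i (step_size i))^-1 *: (w - q).
have -> : w = out_val F p i (step_size i) *: v + q.
  by rewrite /v scalerA mulfV // scale1r subrK.
move=> /stepE hv /=; congr (_ *: _ + _).
pose Y j := if j == i then v else 0.
have : op_inv (op_add (op_map (mxop M)) (Phi A' p)) 0 Y.
  apply/resolvent_PhiE => j; rewrite sub0r.
  have [->|ji] := eqVneq j i.
    by rewrite rowi ?/Y ?eqxx // => a /negPf ->.
  by apply/hat0; rewrite // /Y (negPf ji).
by rewrite yE => <-; rewrite /Y eqxx.
Qed.

(** Only the first and the last space are [H^d]; in between, the state holds the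
    input and the entries of [y] computed so far, padded by zeros. *)
Lemma resolvent_frugal (d_gt0 : (0 < d)%N) :
  (forall A, fix_set (T A) !=set0 <-> zer (op_sum A) !=set0) ->
  frugal_splitting_operator T.
Proof.
move=> fix_zer; have [pF trigL _ _] := Mker; set L := M + Gamma p in trigL.
pose ds i := if (i == 0%N) || (i == n) then d else (d + n)%N.
have dsn : ds n = d by rewrite /ds eqxx orbT.
pose g := step_size.
pose Q i := (arg_coef p i (g i))^-1 *: row i (row_mx N (- L)).
pose e i : 'M[R]_(d + n, 1) := delta_mx (rshift d i) ord0.
pose B i := 1%:M - ((out_val F p i (g i))^-1 * out_arg F p i) *: (e i *m Q i).
pose C i := (out_val F p i (g i))^-1 *: e i.
(* The last step also forms the output [z - U z + V y]. *)
pose W (k : nat) := if k == n then col_mx (row_mx (1%:M - U) V) 0 else 1%:M.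
pose P k := incl_mx R (ds k) (d + n).
pose I k := incl_mx R (d + n) (ds k).
pose Bs k i := P k.+1 *m (W k.+1 *m (B i *m I k)).
pose Cs k i := P k.+1 *m (W k.+1 *m C i).
pose tau k (A : op_tuple ip F) (x : 'I_(ds k) -> H) := let i := insubd p k in
  mxop (Bs k i) x +
  mxop (Cs k i) (fun=> xget 0 (step_op A i (g i) (mxop (Q i *m I k) x ord0))).
have tauE (i : 'I_n) A x : tau i A x = mxop (Bs i i) x +
    mxop (Cs i i) (fun=> xget 0 (step_op A i (g i) (mxop (Q i *m I i) x ord0))).
  by rewrite /tau valKd.
have xget1 (w : H) : xget 0 [set w] = w.
  exact: (xgetPex 0 (ex_intro [set w] w erefl)).
exists ds, erefl, dsn, tau; split=> //.
- by move=> i _; rewrite /ds; case: ifP => // _; rewrite addn_gt0 d_gt0.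
- move=> A z; have [y [yE ->]] := TE A z.
  have /resolvent_PhiE hy :
      op_inv (op_add (op_map (mxop M)) (Phi A p)) (mxop N z) y.
    by rewrite yE.
  pose zs k := @compose_steps R H ds (tau ^~ A) k z.
  pose known k (b : 'I_n) : H := if (b < k)%N then y b else 0.
  pose state k (j : 'I_(d + n)) : H :=
    match fintype.split j with inl a => z a | inr b => known k b end.
  have statelE k a : state k (lshift n a) = z a.
    by rewrite /state (unsplitK (inl a)).
  have staterE k b : state k (rshift d b) = known k b.
    by rewrite /state (unsplitK (inr b)).
  have statel k : (fun a => state k (lshift n a)) = z.
    exact: funext.
  have stater k : (fun b => state k (rshift d b)) = known k.
    exact: funext.
  (* The full row of [L] may be used on the padded state: its entries after the
     diagonal vanish, and the entry [i] of the state is still zero. *)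
  have argE (i : 'I_n) : arg_coef p i (g i) *: mxop (Q i) (state i) ord0 -
      diag_coef F p i (g i) *: y i = mxop N z i - mxop L y i.
    have -> : mxop (Q i) (state i) ord0 =
        (arg_coef p i (g i))^-1 *: mxop (row_mx N (- L)) (state i) i.
      rewrite mxopZ -[LHS]/(_ *: mxop (row i (row_mx N (- L))) (state i) ord0).
      by congr (_ *: _); apply: eq_bigr => j _; rewrite mxE.
    rewrite scalerA mulfV ?arg_coef_neq0 ?step_size_gt0 // scale1r.
    rewrite mxop_row_mx statel stater mxopN.
    rewrite -[(_ + _) i]/(mxop N z i - mxop L (known i) i) -addrA -opprD.
    congr (_ - _); rewrite /mxop (bigD1 i) //= [RHS](bigD1 i) //=.
    rewrite {1}/known ltnn scaler0 add0r diag_step_size addrC.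
    congr (_ + _); last first.
      by rewrite /L mxE GammaE subrr addr0.
    apply: eq_bigr => j ji; rewrite /known; case: ltnP => // ij.
    have /is_trig_mxP -> := trigL; first by rewrite !scale0r.
    by rewrite ltn_neqAle ij andbT eq_sym.
  have stepE (i : 'I_n) : mxop (B i) (state i) + mxop (C i)
      (fun=> xget 0 (step_op A i (g i) (mxop (Q i) (state i) ord0))) = state i.+1.
    have := hy i; rewrite -/L -argE => /hat_op_step -/(_ pF (step_size_gt0 i)).
    have [w ->] := step_op_single A i (mxop (Q i) (state i) ord0).
    rewrite xget1 => /= <-.
    have t0 := out_val_neq0 F p i (step_size_gt0 i).
    apply: funext => j.
    rewrite mxopD mxop1 mxopN mxopZ mxopM.
    rewrite -[LHS]/(state i j - (_ * _) *: mxop (e i) (mxop (Q i) (state i)) j + _).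
    rewrite mxop_col1 [mxop (e i) _ j]/mxop big_ord1 [C i j ord0]mxE.
    rewrite scalerDr !scalerA [_ * out_val _ _ _ _]mulrAC mulVf // mul1r.
    rewrite [_ * out_arg _ _ _]mulrAC addrA subrK mxE eqxx andbT.
    case: (split_ordP j) => [a ->|b ->].
      by rewrite !statelE eq_lrshift scale0r addr0.
    rewrite !staterE eq_rshift /known ltnS; have [->|bi] := eqVneq b i.
      by rewrite ltnn leqnn add0r scale1r.
    by rewrite scale0r addr0 [(b <= i)%N]leq_eqVlt [_ == _ :> nat](negPf bi).
  have zsP k : (0 < k <= n)%N -> mxop (I k.-1) (zs k.-1) = state k.-1 ->
      zs k = mxop (P k) (mxop (W k) (state k)).
    case: k => // k /= kn zk; rewrite /zs /= -/(zs k) (tauE (Ordinal kn)) /=.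
    by rewrite !mxopM zk -!mxop_addr (stepE (Ordinal kn)).
  have zsI k : (k < n)%N -> mxop (I k) (zs k) = state k.
    elim: k => [_|k IHk kn].
      apply: funext => j; case: (split_ordP j) => [a ->|b ->].
        by rewrite statelE (@mxop_incl _ _ _ _ _ _ a).
      by rewrite staterE mxop_incl_out //= leq_addr.
    have -> := zsP k.+1 (ltnW kn) (IHk (ltnW kn)).
    rewrite /W ltn_eqF // mxop1 mxop_inclK //.
    by rewrite /ds /= ltn_eqF.
  have n_gt0 : (0 < n)%N by apply: leq_trans (ltn_ord p).
  rewrite [X in compose_steps _ X](_ : _ = z); last first.
    by apply: funext => a; congr z; exact: val_inj.
  apply: funext => a; rewrite /pow_cast -/(zs n).
  have n1_lt : (n.-1 < n)%N by rewrite prednK.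
  have n_le : (0 < n <= n)%N by rewrite n_gt0 leqnn.
  have -> := zsP n n_le (zsI _ n1_lt).
  rewrite (@mxop_incl _ _ _ _ _ _ (lshift n a)) // /W eqxx.
  have -> : mxop (col_mx (row_mx (1%:M - U) V) (0 : 'M[R]_(n, d + n)))
      (state n) (lshift n a) =
      mxop (row_mx (1%:M - U) V) (state n) a.
    by apply: eq_bigr => j _; rewrite col_mxEu.
  rewrite mxop_row_mx statel stater mxopD mxop1 mxopN.
  by congr (_ + mxop V _ a); apply: funext => b; rewrite /known ltn_ord.
move=> i; exists (Bs i i), (Cs i i), (Q i *m I i), (g i).
split=> [|A x]; first exact: step_size_gt0.
have [w wE] := step_op_single A i (mxop (Q i *m I i) x ord0).
by exists w; split=> //; rewrite tauE wE xget1.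
Qed.

End Sufficiency.

Theorem theorem5p1 (R : realType) (H : completeNormedModType R)
    (ip : {dot H for (@idfun R)}) (ip_norm : induces_norm ip)
    (H_dim : dim_ge2 H) (n d : nat) (n_gt0 : (0 < n)%N) (d_gt0 : (0 < d)%N)
    (F : {set 'I_n}) (F_proper : F \proper 'I_n)
    (p : 'I_n) (p_notin_F : p \notin F)
    (T : op_tuple ip F -> ('I_d -> H) -> ('I_d -> H)) :
  frugal_splitting_operator T <->
  exists (M : 'M[R]_n) (N : 'M[R]_(n, d)) (U : 'M[R]_d) (V : 'M[R]_(d, n)),
    [/\ generalized_primal_dual_resolvent T p M N U V,
        p_kernel F p M,
        @ker_mx R H _ _ (row_mx U (- V)) `<=` @ker_mx R H _ _ (row_mx N (- M)) &
        @ran_mx R H _ _ V `<=` @ran_mx R H _ _ U].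
Proof.
split=> [Tfrugal|[M [N [U [V [TE Mker kerUV ranVU]]]]]]; last first.
  exact: resolvent_frugal TE Mker d_gt0 (fixed_points_iff_zeros TE kerUV ranVU).
have [M [N [U [V [TE Mker]]]]] := frugal_primal_dual_resolvent p_notin_F Tfrugal.
have [_ [_ [_ [_ [_ fix_zer _ _]]]]] := Tfrugal.
exists M, N, U, V; split=> //.
- exact: fixed_point_ker TE H_dim (fun A => (fix_zer A).1).
- exact: fixed_point_ran TE p_notin_F (fun A => (fix_zer A).2).
Qed.
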